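(* Let $L>0$, $\epsilon>0$ and $N=\lceil L/\epsilon\rceil$ with $N\ge 2$. The Manhattan Markov Trace Model $(\mathcal T_\epsilon,\Psi_\epsilon)$ is balanced, uniformly selective and strongly connected. Consequently it has a unique stationary distribution, and this distribution is the uniform distribution on $S(\mathcal T_\epsilon)$. Moreover $(\mathcal T_\epsilon,\Psi_\epsilon)$ is simple, and hence its stationary spatial distribution $\mathfrak s$ and stationary destination distributions $\mathfrak d_u$ are given, for all $u,v\in V_\epsilon$, by $$\mathfrak s(u)=\frac{|\mathcal T_{\epsilon,u}|}{|S(\mathcal T_\epsilon)|},\qquad \mathfrak d_u(v)=\frac{|\{T\in\mathcal T_{\epsilon,u}: T_{end}=v\}|}{|\mathcal T_{\epsilon,u}|},$$ where $\mathcal T_{\epsilon,u}=\{T\in\mathcal T_\epsilon:\#_{T,u}\ge1\}$.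
   Context: A trace is a finite sequence $T=(T(0),\dots,T(|T|-1))$ of at least two points; $T_{start}=T(0)$, $T_{end}=T(|T|-1)$. For a set of traces $\mathcal T$: $\mathcal T^{\mathrm{out}}(u)=\{T: T_{start}=u\}$, $\mathcal T^{\mathrm{in}}(u)=\{T:T_{end}=u\}$, $\mathcal T(u,v)=\mathcal T^{\mathrm{out}}(u)\cap\mathcal T^{\mathrm{in}}(v)$, $P(\mathcal T)=\{u:\mathcal T^{\mathrm{out}}(u)\neq\emptyset\}$, $S(\mathcal T)=\{\langle T,i\rangle: T\in\mathcal T,1\le i\le|T|-1\}$. A Markov Trace Model (MTM) is a pair $\mathcal D=(\mathcal T,\Psi)$ where $\mathcal T$ is a set of traces such that every $T\in\mathcal T$ has some $T'\in\mathcal T$ with $T'_{start}=T_{end}$, $|P(\mathcal T)|<\infty$, and $\Psi=\{\psi_u\}_{u\in P(\mathcal T)}$ with $\psi_u$ a probability distribution over $\mathcal T^{\mathrm{out}}(u)$. A stationary distribution of $\mathcal D$ is a stationary distribution of the Markov chain on $S(\mathcal T)$ with $\Pr(\langle T,i\rangle\to\langle T,i+1\rangle)=1$ for $1\le i<|T|-1$, $\Pr(\langle T,|T|-1\rangle\to\langle T',1\rangle)=\psi_{T_{end}}(T')$ for $T'\in\mathcal T^{\mathrm{out}}(T_{end})$, all other transition probabilities $0$. $\mathcal D$ is uniformly selective if each $\psi_u$ is uniform; balanced if $|\mathcal T^{\mathrm{in}}(u)|=|\mathcal T^{\mathrm{out}}(u)|$ for all $u\in P(\mathcal T)$; strongly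 connected if for all distinct $u,v\in P(\mathcal T)$ there are $z_0=u,z_1,\dots,z_k=v$ in $P(\mathcal T)$ with $\sum_{T\in\mathcal T(z_i,z_{i+1})}\psi_{z_i}(T)>0$ for all $i<k$. Let $\#_{T,u}=|\{i: 1\le i\le|T|-1,\ T(i)=u\}|$; $\mathcal D$ is simple if $\#_{T,u}\le1$ for all $T\in\mathcal T$ and all points $u$. Given the stationary distribution $\pi$, the stationary spatial distribution is $\mathfrak s(u)=\sum_{\langle T,i\rangle\in S(\mathcal T),\,T(i)=u}\pi(\langle T,i\rangle)$ and the stationary destination distribution is $\mathfrak d_u(v)=\frac1{\mathfrak s(u)}\sum_{\langle T,i\rangle\in S(\mathcal T),\,T(i)=u,\,T_{end}=v}\pi(\langle T,i\rangle)$. Manhattan MTM: $V_\epsilon=\{(i\epsilon,j\epsilon): i,j\in\{0,\dots,N-1\}\}$, with two points adjacent when their Euclidean distance is $\epsilon$. For distinct $v=(x,y)$ and $u=(x',y')$ in $V_\epsilon$ the feasible paths from $v$ to $u$ are: the grid path consisting of the horizontal segment from $(x,y)$ to $(x',y)$ followed by the vertical segment to $(x',y')$, and the grid path consisting of the vertical segment from $(x,y)$ to $(x,y')$ followed by the horizontal segment to $(x',y')$ (these coincide if $x=x'$ or $y=y'$). $\mathcal T_\epsilon$ is the set of point sequences (listing successive adjacent grid points) of all feasible paths between distinct points of $V_\epsilon$, and $\Psi_\epsilon$ assigns to each $u\in V_\epsilon$ the uniform distribution over $\mathcal T_\epsilon^{\mathrm{out}}(u)$. *)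

(* Defs.v *)
From HB Require Import structures.
From mathcomp Require Import all_boot all_order all_algebra.
From mathcomp Require Import finmap.
From mathcomp Require Import ring.
From mathcomp Require Import all_classical all_reals all_analysis.
Set Implicit Arguments.
Unset Strict Implicit.
Unset Printing Implicit Defensive.
Import Order.TTheory GRing.Theory Num.Theory.
Import numFieldNormedType.Exports.
Local Open Scope classical_set_scope.
Local Open Scope ring_scope.

(* The cardinality of a finite set; its value on infinite sets is junk (0). *)
Definition set_card {T : choiceType} (A : set T) : nat := #|` fset_set A |.

(* A discrete probability distribution over A, given by its mass function
   extended by 0 outside A. *)
Definition distribution_on {R : realType} {T : choiceType}
    (A : set T) (p : T -> R) : Prop :=
  [/\ forall x, 0 <= p x,
      forall x, ~ A x -> p x = 0
    & (\esum_(x in A) (p x)%:E = 1)%E].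

Definition uniform_mass (R : realType) {T : choiceType} (A : set T) (x : T) : R :=
  if x \in A then (set_card A)%:R^-1 else 0.

Definition uniform_on {R : realType} {T : choiceType}
    (A : set T) (p : T -> R) : Prop :=
  finite_set A /\ p = uniform_mass R A.

Section MarkovTraceModel.
Context {R : realType} {pt : pointedType}.

(* Traces have at least two points (see is_MTM), so the default value of nth
   is never reached at the indices used below. *)
Definition trace_at (T : seq pt) (i : nat) : pt := nth point T i.
Definition trace_start (T : seq pt) : pt := trace_at T 0.
Definition trace_end (T : seq pt) : pt := trace_at T (size T).-1.

(* #_{T,u}: the index 0 is not counted. *)
Definition visits (T : seq pt) (u : pt) : nat :=
  #|[pred i : 'I_(size T) | (0 < i)%N && (trace_at T i == u)]|.

(* psi u is meaningful only for u in sources. *)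
Record trace_model := TraceModel {
  traces : set (seq pt);
  psi : pt -> seq pt -> R }.

Implicit Types (D : trace_model) (u v : pt) (s : seq pt * nat).

Definition traces_out D u : set (seq pt) :=
  [set T | traces D T /\ trace_start T = u].
Definition traces_in D u : set (seq pt) :=
  [set T | traces D T /\ trace_end T = u].
Definition traces_between D u v : set (seq pt) :=
  traces_out D u `&` traces_in D v.
Definition sources D : set pt := [set u | traces_out D u !=set0].
Definition states D : set (seq pt * nat) :=
  [set s | traces D s.1 /\ (1 <= s.2 <= (size s.1).-1)%N].

Definition is_MTM D : Prop :=
  [/\ forall T, traces D T -> (2 <= size T)%N,
      forall T, traces D T ->
        exists2 T', traces D T' & trace_start T' = trace_end T,
      finite_set (sources D)
    & forall u, sources D u -> distribution_on (traces_out D u) (psi D u)].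

(* Pr(s -> s'), for s and s' in states D. *)
Definition transition D s s' : R :=
  if (s.2 < (size s.1).-1)%N then (s' == (s.1, s.2.+1))%:R
  else if (s'.2 == 1%N) && (s'.1 \in traces_out D (trace_end s.1))
  then psi D (trace_end s.1) s'.1
  else 0.

Definition stationary D (pi : seq pt * nat -> R) : Prop :=
  distribution_on (states D) pi /\
  forall s', states D s' ->
    ((pi s')%:E = \esum_(s in states D) (pi s * transition D s s')%:E)%E.

Definition uniformly_selective D : Prop :=
  forall u, sources D u -> uniform_on (traces_out D u) (psi D u).

Definition balanced D : Prop :=
  forall u, sources D u -> (traces_in D u #= traces_out D u)%card.

Definition strongly_connected D : Prop :=
  forall u v, sources D u -> sources D v -> u <> v ->
  exists (k : nat) (z : nat -> pt),
    [/\ z 0%N = u, z k = v,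
        forall i, (i <= k)%N -> sources D (z i)
      & forall i, (i < k)%N ->
          (0 < \esum_(T in traces_between D (z i) (z i.+1))
                 (psi D (z i) T)%:E)%E].

Definition simple_model D : Prop :=
  forall T u, traces D T -> (visits T u <= 1)%N.

(* The sums below are bounded by 1 when pi is a distribution, so fine only
   changes their type. *)
Definition spatial D (pi : seq pt * nat -> R) u : R :=
  fine (\esum_(s in [set s | states D s /\ trace_at s.1 s.2 = u]) (pi s)%:E)%E.

Definition destination D (pi : seq pt * nat -> R) u v : R :=
  (spatial D pi u)^-1 *
  fine (\esum_(s in [set s | [/\ states D s, trace_at s.1 s.2 = u
                               & trace_end s.1 = v]]) (pi s)%:E)%E.

Definition traces_through D u : set (seq pt) :=
  [set T | traces D T /\ (1 <= visits T u)%N].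

End MarkovTraceModel.
Arguments trace_model : clear implicits.

Section Manhattan.
Context {R : realType}.
Implicit Types (eps : R) (N : nat).

Definition grid_point eps (i j : nat) : R * R := (i%:R * eps, j%:R * eps).

Definition grid eps N : set (R * R) :=
  [set p | exists i j : 'I_N, p = grid_point eps i j].

Definition adjacent eps : rel (R * R) :=
  fun p q => Num.sqrt ((q.1 - p.1) ^+ 2 + (q.2 - p.2) ^+ 2) == eps.

(* i, i+1, ..., i' if i <= i', and i, i-1, ..., i' otherwise. *)
Definition steps (i i' : nat) : seq nat :=
  if (i <= i')%N then iota i (i' - i).+1 else rev (iota i' (i - i').+1).

(* From (i, j) to (i', j') in grid coordinates, through the corner (i', j);
   behead avoids listing the corner twice. *)
Definition hv_path eps (i j i' j' : nat) : seq (R * R) :=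
  [seq grid_point eps k j | k <- steps i i'] ++
  [seq grid_point eps i' k | k <- behead (steps j j')].

(* Same, through the corner (i, j'). *)
Definition vh_path eps (i j i' j' : nat) : seq (R * R) :=
  [seq grid_point eps i k | k <- steps j j'] ++
  [seq grid_point eps k j' | k <- behead (steps i i')].

Lemma adjacent_gridl eps (i j : nat) : 0 < eps ->
  adjacent eps (grid_point eps i j) (grid_point eps i.+1 j) /\
  adjacent eps (grid_point eps i.+1 j) (grid_point eps i j).
Proof.
move=> e0; rewrite /adjacent /= !subrr expr0n /= !addr0 -!mulrBl -natr1.
have -> : i%:R + 1 - i%:R = 1 :> R by ring.
have -> : i%:R - (i%:R + 1) = -1 :> R by ring.
by rewrite mul1r mulN1r sqrrN sqrtr_sqr gtr0_norm // eqxx.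
Qed.

Lemma adjacent_gridr eps (i j : nat) : 0 < eps ->
  adjacent eps (grid_point eps i j) (grid_point eps i j.+1) /\
  adjacent eps (grid_point eps i j.+1) (grid_point eps i j).
Proof.
move=> e0; rewrite /adjacent /= !subrr expr0n /= !add0r -!mulrBl -natr1.
have -> : j%:R + 1 - j%:R = 1 :> R by ring.
have -> : j%:R - (j%:R + 1) = -1 :> R by ring.
by rewrite mul1r mulN1r sqrrN sqrtr_sqr gtr0_norm // eqxx.
Qed.

Definition next_to (a b : nat) : bool := (b == a.+1) || (a == b.+1).

Lemma steps_path (i i' : nat) : exists s,
  [/\ steps i i' = i :: s, last i s = i' & path next_to i s].
Proof.
have P n k : path next_to k (iota k.+1 n).
  by elim: n k => //= n IH k; rewrite IH /next_to eqxx.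
have S n k : sorted next_to (rev (iota k n)).
  rewrite rev_sorted; case: n => //= n.
  by rewrite (eq_path (e' := next_to)) // => a b; rewrite /next_to orbC.
have L n k : last k (iota k.+1 n) = (k + n)%N.
  by elim: n k => /= [|n IH] k; rewrite ?addn0 // IH addSnnS.
rewrite /steps; case: leqP => [le|/ltnW le].
  by exists (iota i.+1 (i' - i)); split=> //; rewrite L subnKC.
have := S (i - i').+1 i'.
rewrite -{1 2}addn1 iotaD /= rev_cat /= subnKC // => H.
exists (rev (iota i' (i - i'))); split=> //.
case E: (i - i')%N => [|n] /=; last by rewrite rev_cons last_rcons.
by apply/eqP; rewrite eqn_leq le andbT -subn_eq0 E.
Qed.

Lemma hv_path_adjacent eps (i j i' j' : nat) : 0 < eps ->
  exists s, [/\ hv_path eps i j i' j' = grid_point eps i j :: s,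
    last (grid_point eps i j) s = grid_point eps i' j'
    & path (adjacent eps) (grid_point eps i j) s].
Proof.
move=> e0; rewrite /hv_path.
have [s [-> ls ps]] := steps_path i i'; have [t [-> lt pt]] := steps_path j j'.
rewrite /=; eexists; split; first by [].
  by rewrite last_cat (last_map (grid_point eps ^~ j)) ls last_map lt.
rewrite cat_path (last_map (grid_point eps ^~ j)) ls; apply/andP; split.
  rewrite (path_map (f := grid_point eps ^~ j)); apply: (sub_path _ ps) => a b /=.
  by case/orP=> /eqP ->; [case: (adjacent_gridl a j e0)|case: (adjacent_gridl b j e0)].
rewrite (path_map (f := grid_point eps i')); apply: (sub_path _ pt) => a b /=.
by case/orP=> /eqP ->; [case: (adjacent_gridr i' a e0)|case: (adjacent_gridr i' b e0)].
Qed.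

Lemma vh_path_adjacent eps (i j i' j' : nat) : 0 < eps ->
  exists s, [/\ vh_path eps i j i' j' = grid_point eps i j :: s,
    last (grid_point eps i j) s = grid_point eps i' j'
    & path (adjacent eps) (grid_point eps i j) s].
Proof.
move=> e0; rewrite /vh_path.
have [s [-> ls ps]] := steps_path i i'; have [t [-> lt pt]] := steps_path j j'.
rewrite /=; eexists; split; first by [].
  by rewrite last_cat last_map lt (last_map (grid_point eps ^~ j')) ls.
rewrite cat_path last_map lt; apply/andP; split.
  rewrite (path_map (f := grid_point eps i)); apply: (sub_path _ pt) => a b /=.
  by case/orP=> /eqP ->; [case: (adjacent_gridr i a e0)|case: (adjacent_gridr i b e0)].
rewrite (path_map (f := grid_point eps ^~ j')); apply: (sub_path _ ps) => a b /=.
by case/orP=> /eqP ->; [case: (adjacent_gridl a j' e0)|case: (adjacent_gridl b j' e0)].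
Qed.

Definition feasible_path eps N (v u : R * R) (T : seq (R * R)) : Prop :=
  exists i j i' j' : 'I_N,
    [/\ v = grid_point eps i j, u = grid_point eps i' j'
      & T = hv_path eps i j i' j' \/ T = vh_path eps i j i' j'].

Definition manhattan_traces eps N : set (seq (R * R)) :=
  [set T | exists v u, [/\ grid eps N v, grid eps N u, v <> u
                         & feasible_path eps N v u T]].

Definition manhattan eps N : trace_model R (R * R)%type :=
  {| traces := manhattan_traces eps N;
     psi := fun u => uniform_mass R
       [set T | manhattan_traces eps N T /\ trace_start T = u] |}.

End Manhattan.

(* Main.v *)
Require Import Defs.
From HB Require Import structures.
From mathcomp Require Import all_boot all_order all_algebra.
From mathcomp Require Import finmap.
From mathcomp Require Import all_classical all_reals all_analysis.
Set Implicit Arguments.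
Unset Strict Implicit.
Unset Printing Implicit Defensive.
Import Order.TTheory GRing.Theory Num.Theory.
Import numFieldNormedType.Exports.
Local Open Scope classical_set_scope.
Local Open Scope ring_scope.

(** The inflow into [<T, i+1>] comes only from [<T, i>], so a stationary
distribution is constant along each trace; the inflow into [<T, 1>] depends
only on [u = T_start], and with uniform choice it is the sum of the weights of
the traces ending at [u] divided by the number of traces leaving [u].  For a
balanced model this is an average, so constant weights are stationary.
Conversely the weight of a point is the average of the weights of its
predecessors: where it is maximal it is maximal at all predecessors, and
strong connectivity makes it constant.

Reversal exchanges the horizontal-first and vertical-first grid paths, whence
the Manhattan model is balanced.  Feasible paths have no repeated point, so
the model is simple and the states at [u] correspond to the traces through [u].
*)

(** * Finite sums, cardinalities and uniform mass functions *)

Section FiniteSets.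
Context {R : realType}.

(** Passes from the extended-real sums of the definitions to finite real sums, where subtraction and
    division are available. *)
Lemma esum_fsum (T : choiceType) (A : set T) (f : T -> R) :
  finite_set A -> (forall x, A x -> 0 <= f x) ->
  (\esum_(x in A) (f x)%:E = (\sum_(x \in A) f x)%:E)%E.
Proof.
move=> fA f0; rewrite esum_fset //; first by rewrite fsumEFin.
by move=> x /set_mem Ax; rewrite lee_fin f0.
Qed.

Lemma fsum_const (T : choiceType) (A : set T) (c : R) :
  finite_set A -> \sum_(x \in A) c = c * (set_card A)%:R.
Proof.
move=> fA; rewrite fsbig_finite // big_const_seq count_predT iter_addr_0.
by rewrite mulr_natr.
Qed.

Lemma set_card_eq (T T' : choiceType) (A : set T) (B : set T') :
  finite_set A -> (A #= B)%card -> set_card A = set_card B.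
Proof.
move=> /finite_setP[n An] AB; rewrite /set_card (card_fset_set An).
by rewrite (card_fset_set (n := n)) // (card_eq_trans _ An) // card_esym.
Qed.

Lemma set_card_gt0 (T : choiceType) (A : set T) :
  finite_set A -> A !=set0 -> (0 < set_card A)%N.
Proof.
move=> fA [x Ax]; rewrite cardfs_gt0; apply/fset0Pn; exists x.
by rewrite in_fset_set // mem_set.
Qed.

Lemma exists_max_finite_set (T : choiceType) (A : set T) (f : T -> R) :
  finite_set A -> A !=set0 ->
  exists2 x, A x & forall y, A y -> f y <= f x.
Proof.
move=> fA [a Aa]; have ha : a \in fset_set A by rewrite in_fset_set // mem_set.
case: (@arg_maxP _ _ _ [` ha]%fset predT (fun x => f (val x))) => // x _ xmax.
exists (val x); first by have := valP x; rewrite in_fset_set // => /set_mem.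
move=> y Ay; have hy : y \in fset_set A by rewrite in_fset_set // mem_set.
exact: (xmax [` hy]%fset).
Qed.

Lemma uniform_mass_distribution (T : choiceType) (A : set T) :
  finite_set A -> A !=set0 -> distribution_on A (uniform_mass R A).
Proof.
move=> fA A0; have cA : (set_card A)%:R != 0 :> R.
  by rewrite pnatr_eq0 -lt0n set_card_gt0.
split=> [x|x nAx|].
- by rewrite /uniform_mass; case: ifP => // _; rewrite invr_ge0.
- by rewrite /uniform_mass memNset.
rewrite esum_fsum //; last first.
  by move=> x _; rewrite /uniform_mass; case: ifP => // _; rewrite invr_ge0.
under eq_fsbigr => x xA do rewrite /uniform_mass xA.
by rewrite fsum_const // mulVf.
Qed.

(** Both the spatial distribution and the numerator of the destination distribution are sums of this
    form, with [B] the set of states. *)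
Lemma esum_uniform_mass (T : choiceType) (A B : set T) :
  finite_set B -> A `<=` B ->
  (\esum_(x in A) (uniform_mass R B x)%:E =
   ((set_card A)%:R / (set_card B)%:R)%:E)%E.
Proof.
move=> fB AB; have fA := sub_finite_set AB fB; rewrite esum_fsum //.
  rewrite (eq_fsbigr (fun=> (set_card B)%:R^-1)); last first.
    by move=> x /set_mem/AB Bx; rewrite /uniform_mass mem_set.
  by rewrite fsum_const // mulrC.
by move=> x _; rewrite /uniform_mass; case: ifP => // _; rewrite invr_ge0.
Qed.

End FiniteSets.

(** * Stationary distributions of balanced, uniformly selective models *)

Section FiniteModels.
Context {R : realType} {pt : pointedType}.
Variable D : trace_model R pt.
Hypotheses (MTM_D : is_MTM D) (fin_D : finite_set (traces D)).

Lemma finite_traces_in u : finite_set (traces_in D u).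
Proof. by apply: sub_finite_set fin_D => T []. Qed.

Lemma finite_traces_out u : finite_set (traces_out D u).
Proof. by apply: sub_finite_set fin_D => T []. Qed.

(** The maximal trace length bounds every index. *)
Lemma finite_states : finite_set (states D).
Proof.
pose m := \max_(T <- fset_set (traces D)) size T.
apply: (@sub_finite_set _ _ (traces D `*` `I_m.+1)).
  move=> [T i] [/= DT /andP[_ iT]]; split=> //=.
  rewrite ltnS (leq_trans iT) // (leq_trans (leq_pred _)) //.
  by apply: leq_bigmax_seq => //; rewrite in_fset_set // mem_set.
exact: finite_setX.
Qed.

Lemma source_start T : traces D T -> sources D (trace_start T).
Proof. by move=> DT; exists T. Qed.

Lemma state_first T : traces D T -> states D (T, 1%N).
Proof.
by move=> DT; split => //=; case: MTM_D => /(_ _ DT); case: (size T) => [|[]].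
Qed.

Lemma state_last T : traces D T -> states D (T, (size T).-1).
Proof.
move=> DT; split => //=; rewrite leqnn andbT.
by case: MTM_D => /(_ _ DT); case: (size T) => [|[]].
Qed.

Lemma transition_succ s T i : states D s -> states D (T, i.+2) ->
  transition D s (T, i.+2) = (s == (T, i.+1))%:R.
Proof.
case: s => U k [/= DU /andP[k0 kU]] [/= DT iT]; rewrite /transition /=.
case: ifP => lk.
  by rewrite !xpair_eqE eqSS eq_sym [(i.+1 == k)%N]eq_sym.
(* Here [k] is the last index of [U], from which only index 1 is reachable. The state cannot be
   [(T, i.+1)] either, since [i.+2] is still an index of [T]. *)
rewrite xpair_eqE; case: eqP => //= UT; case: eqP => //= ki.
by move: lk; rewrite UT ki iT.
Qed.

Lemma transition_first s T : states D s -> traces D T ->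
  transition D s (T, 1%N) =
  if (s.2 == (size s.1).-1) && (trace_end s.1 == trace_start T)
  then psi D (trace_start T) T else 0.
Proof.
case: s => U k [/= DU /andP[k0 kU]] DT; rewrite /transition /=.
rewrite ltn_neqAle kU andbT xpair_eqE; case: eqP => /= [_|_].
  case: (eqVneq (trace_end U) (trace_start T)) => [->|ne].
    by rewrite mem_set.
  by rewrite memNset // => -[_ e]; rewrite e eqxx in ne.
by rewrite eqSS [(0 == k)%N]eq_sym (gtn_eqF k0) andbF.
Qed.

Lemma inflow_succ (p : seq pt * nat -> R) T i : states D (T, i.+2) ->
  \sum_(s \in states D) p s * transition D s (T, i.+2) = p (T, i.+1).
Proof.
move=> DT; have DT' : states D (T, i.+1).
  by case: DT => /= ? iT; split => //=; exact: ltnW.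
rewrite -(@fsbig_widen _ _ _ _ [set (T, i.+1)]).
- by rewrite fsbig_set1 transition_succ // eqxx mulr1.
- by move=> s ->.
move=> s [Ds /eqP ne] /=.
by rewrite transition_succ // (negbTE ne) mulr0.
Qed.

(** Only the last states of traces ending at the start of [T] can lead to [(T, 1)]. They are indexed
    injectively by these traces, and all move to [(T, 1)] with the same probability, which factors
    out. *)
Lemma inflow_first (p : seq pt * nat -> R) T : traces D T ->
  \sum_(s \in states D) p s * transition D s (T, 1%N) =
  (\sum_(U \in traces_in D (trace_start T)) p (U, (size U).-1))
    * psi D (trace_start T) T.
Proof.
move=> DT; pose h U : seq pt * nat := (U, (size U).-1).
rewrite -(@fsbig_widen _ _ _ _ (h @` traces_in D (trace_start T))).
- rewrite fsbig_image; last by move=> U V _ _ [].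
  rewrite mulr_fsuml; apply: eq_fsbigr => U /set_mem[DU eU].
  by rewrite transition_first ?eU /= ?eqxx //; exact: state_last.
- by move=> _ [U [DU _] <-]; exact: state_last.
move=> s [Ds nh] /=; rewrite transition_first //.
case: ifP => [/andP[/eqP e1 /eqP e2]|]; last by rewrite mulr0.
case: nh; exists s.1; first by split => //; case: Ds.
by rewrite /h -e1; case: (s).
Qed.

End FiniteModels.

(** * Uniform selection and balance: existence of the stationary distribution *)

Section StationaryDistribution.
Context {R : realType} {pt : pointedType}.
Variable D : trace_model R pt.
Hypotheses (MTM_D : is_MTM D) (sel_D : uniformly_selective D).

(** A uniform distribution lives on a finite set, so the traces form a finite union, over the
    sources, of finite sets. *)
Lemma selective_finite_traces : finite_set (traces D).
Proof.
case: MTM_D => _ _ fS _.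
rewrite (_ : traces D = \bigcup_(u in sources D) traces_out D u).
  by apply: bigcup_finite => // u /sel_D[].
apply/seteqP; split => [T DT|T [u _ []//]].
by exists (trace_start T) => //; exact: source_start.
Qed.
Let fin_D := selective_finite_traces.
Let fin_S := finite_states fin_D.

Hypothesis bal_D : balanced D.

Lemma balanced_card u : sources D u ->
  set_card (traces_in D u) = set_card (traces_out D u).
Proof. by move=> /bal_D; apply: set_card_eq; exact: finite_traces_in. Qed.

Lemma psi_start T : traces D T ->
  psi D (trace_start T) T = (set_card (traces_out D (trace_start T)))%:R^-1.
Proof.
move=> DT; have [_ ->] := sel_D (source_start DT).
by rewrite /uniform_mass mem_set.
Qed.

Lemma card_out_neq0 u : sources D u -> (set_card (traces_out D u))%:R != 0 :> R.
Proof.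
by move=> Su; rewrite pnatr_eq0 -lt0n set_card_gt0 //; exact: finite_traces_out.
Qed.

(** [psi] is constrained only at sources; every trace having a successor, the end of [s.1] is a
    source. *)
Lemma transition_ge0 s s' : states D s -> 0 <= transition D s s'.
Proof.
move=> [Ds _]; rewrite /transition; case: ifP => // _; case: ifP => // _.
case: MTM_D => _ /(_ _ Ds)[T DT eT] _ psiP.
by have [] := psiP (trace_end s.1); first by rewrite -eT; exact: source_start.
Qed.

Lemma stationaryE (p : seq pt * nat -> R) : distribution_on (states D) p ->
  stationary D p <->
  forall s', states D s' ->
    p s' = \sum_(s \in states D) p s * transition D s s'.
Proof.
move=> dp; have p0 : forall s, 0 <= p s by case: dp.
have E s' : (\esum_(s in states D) (p s * transition D s s')%:E =
    (\sum_(s \in states D) p s * transition D s s')%:E)%E.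
  by rewrite esum_fsum // => s Ss; rewrite mulr_ge0 // transition_ge0.
split=> [[_ st] s' /st|st]; first by rewrite E => -[].
by split => // s' /st; rewrite E => ->.
Qed.

Lemma uniform_stationary : traces D !=set0 ->
  stationary D (uniform_mass R (states D)).
Proof.
move=> [T0 DT0]; apply/stationaryE.
  by apply: uniform_mass_distribution => //; exists (T0, 1%N); exact: state_first.
have unif s : states D s ->
    uniform_mass R (states D) s = (set_card (states D))%:R^-1.
  by move=> Ss; rewrite /uniform_mass mem_set.
(* Index 0 carries no state. At index 1 the number of incoming traces cancels the number of outgoing
   ones; at later indices the inflow is the weight of the preceding state. *)
move=> [T [|[|i]]] Ss'; first by case: Ss'.
  have DT : traces D T by case: Ss'.
  rewrite inflow_first // unif // psi_start //.
  rewrite (eq_fsbigr (fun=> (set_card (states D))%:R^-1)); last first.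
    by move=> U /set_mem[DU _]; rewrite unif //; exact: state_last.
  rewrite fsum_const; last exact: finite_traces_in.
  rewrite balanced_card; last exact: source_start.
  by rewrite mulfK //; apply: card_out_neq0; exact: source_start.
rewrite inflow_succ // !unif //.
by case: Ss' => /= ? iT; split => //=; exact: ltnW.
Qed.

(** * Uniqueness by a maximum principle *)

Section Uniqueness.
Variable p : seq pt * nat -> R.
Hypothesis stat_p : stationary D p.

Lemma stationary_const_on_trace T i : states D (T, i.+1) ->
  p (T, i.+1) = p (T, 1%N).
Proof.
elim: i => // i IH Si.
have Si' : states D (T, i.+1).
  by case: Si => /= ? iT; split => //=; exact: ltnW.
by rewrite -(IH Si') ((stationaryE stat_p.1).1 stat_p _ Si) inflow_succ.
Qed.

(* By stationarity, the mass of any state on a trace leaving [u]. *)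
Definition source_weight u : R :=
  (\sum_(U \in traces_in D u) p (U, (size U).-1))
    / (set_card (traces_out D u))%:R.

Lemma stationary_source_weight s :
  states D s -> p s = source_weight (trace_start s.1).
Proof.
case: s => T [|i] Ss; first by case: Ss.
have DT : traces D T by case: Ss.
rewrite stationary_const_on_trace //.
rewrite ((stationaryE stat_p.1).1 stat_p); last exact: state_first.
by rewrite inflow_first // psi_start.
Qed.

(** The last state of an incoming trace has the weight of all states of that trace, hence the weight
    of its start. *)
Lemma source_weight_average u : sources D u ->
  source_weight u * (set_card (traces_out D u))%:R =
  \sum_(U \in traces_in D u) source_weight (trace_start U).
Proof.
move=> Su; rewrite /source_weight divfK ?card_out_neq0 //.
apply: eq_fsbigr => U /set_mem[DU _].
by rewrite stationary_source_weight //; exact: state_last.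
Qed.

(** The differences [f U] are nonnegative by maximality. By balance the constant part sums to the
    weight of [u] times the number of outgoing traces, so the averaging identity makes their total
    zero and each of them vanishes. *)
Lemma source_weight_max_pred u T : sources D u ->
  (forall v, sources D v -> source_weight v <= source_weight u) ->
  traces_in D u T -> source_weight (trace_start T) = source_weight u.
Proof.
move=> Su umax inT; apply/eqP; rewrite eq_sym -subr_eq0; apply/eqP.
pose f U := source_weight u - source_weight (trace_start U).
have fin := finite_traces_in fin_D u.
apply: (@pfsumr_eq0 _ _ (traces_in D u) f) => //.
  by move=> U [DU _]; rewrite subr_ge0 umax //; exact: source_start.
rewrite fsbig_split //= fsum_const // balanced_card // source_weight_average //.
rewrite !fsbig_finite //= -big_split /=; apply: big1 => U _; exact: subrr.
Qed.

Lemma source_weight_const : strongly_connected D ->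
  forall u v, sources D u -> sources D v -> source_weight u = source_weight v.
Proof.
move=> conn u0 v0 Su0 Sv0; case: MTM_D => _ _ fS _.
have [m Sm mmax] := exists_max_finite_set source_weight fS (ex_intro _ u0 Su0).
suff E v : sources D v -> source_weight v = source_weight m by rewrite !E.
move=> Sv; have [->//|/eqP vm] := eqVneq v m.
have [k [z [z0 zk Sz pos]]] := conn _ _ Sv Sm vm.
(* Maximality passes from the end of a trace to its start, so the chain from [v] to the maximizer
   [m] is traversed backwards. *)
suff Ez i : (i <= k)%N -> source_weight (z (k - i)%N) = source_weight m.
  by rewrite -(Ez k) // subnn z0.
elim: i => [|i IH ik]; first by rewrite subn0 zk.
have Ei := IH (ltnW ik).
have ki : (k - i = (k - i.+1).+1)%N by rewrite subnSK.
have lt : (k - i.+1 < k)%N by rewrite -ki leq_subr.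
(* A positive sum is not over the empty set, so some trace realizes this link of the chain. *)
have [T [[DT sT] inT]] :
    traces_between D (z (k - i.+1)%N) (z (k - i.+1).+1) !=set0.
  apply/set0P/negP => /eqP e.
  by have := pos _ lt; rewrite e esum_set0 ltxx.
rewrite -ki in inT; rewrite -sT -Ei; apply: source_weight_max_pred => //.
  by apply: Sz; exact: leq_subr.
by move=> w /mmax; rewrite Ei.
Qed.

(** Each state has the weight of the start of its trace, and these weights agree; total mass 1 then
    fixes the common value. *)
Lemma stationary_uniform : strongly_connected D ->
  p = uniform_mass R (states D).
Proof.
move=> conn; have [p0 pout psum] := stat_p.1.
have const s s' : states D s -> states D s' -> p s = p s'.
  move=> Ss Ss'; rewrite !stationary_source_weight //.
  by apply: source_weight_const => //; apply: source_start;
    [case: Ss|case: Ss'].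
apply/funext => s; rewrite /uniform_mass; case: ifPn => [/set_mem Ss|/negP nSs].
  move: psum; rewrite esum_fsum // => -[].
  rewrite (eq_fsbigr (fun=> p s)); last by move=> s' /set_mem Ss'; exact: const.
  rewrite fsum_const // => e.
  apply: (mulIf (x := (set_card (states D))%:R)); rewrite ?e ?mulVf //;
    by rewrite pnatr_eq0 -lt0n set_card_gt0 //; exists s.
by apply: pout => Ss; apply: nSs; rewrite mem_set.
Qed.

End Uniqueness.

Lemma unique_stationary_uniform : traces D !=set0 -> strongly_connected D ->
  unique (stationary D) (uniform_mass R (states D)).
Proof.
move=> D0 conn; split; first exact: uniform_stationary.
by move=> p stp; rewrite (stationary_uniform stp).
Qed.

End StationaryDistribution.

(** * Spatial and destination distributions of simple models *)

Section SimpleModels.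
Context {R : realType} {pt : pointedType}.
Variable D : trace_model R pt.
Hypotheses (fin_D : finite_set (traces D)) (simple_D : simple_model D).
Let fin_S := finite_states fin_D.

Lemma simple_visit_inj T u i j : states D (T, i) -> states D (T, j) ->
  trace_at T i = u -> trace_at T j = u -> i = j.
Proof.
move=> [/= DT /andP[i0 iT]] [_ /= /andP[j0 jT]] Ti Tj.
have ltT k : (0 < k)%N -> (k <= (size T).-1)%N -> (k < size T)%N.
  by move=> k0 kT; rewrite (leq_ltn_trans kT) // ltn_predL; case: (size T) kT;
    case: k k0.
have := simple_D u DT => /card_le1_eqP.
move=> /(_ (Ordinal (ltT _ i0 iT)) (Ordinal (ltT _ j0 jT))).
by rewrite !inE /= i0 j0 Ti Tj eqxx => /(_ isT isT) [].
Qed.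

(** Simplicity makes the first projection injective on the states located at [u], and its image
    consists of traces through [u]. The predicate [P] serves both uses: everything for the spatial
    distribution, a fixed end for the destination one. *)
Lemma simple_card_states_at u (P : set (seq pt)) :
  set_card [set s | [/\ states D s, trace_at s.1 s.2 = u & P s.1]] =
  set_card [set T | traces_through D u T /\ P T].
Proof.
set A := [set s | _]; set B := [set T | _].
have <- : fst @` A = B.
  apply/seteqP; split => [_ [[T i] [Si Ti PT] <-]|T [[DT vT] PT]] /=.
    split => //; split; first by case: Si.
    case: Si => /= DT /andP[i0 iT].
    have iT' : (i < size T)%N.
      by move: iT; case: (size T) => //; rewrite leqNgt i0.
    by apply/card_gt0P; exists (Ordinal iT'); rewrite inE /= i0 Ti eqxx.
  case/card_gt0P: vT => -[i iT]; rewrite inE /= => /andP[i0 /eqP Ti].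
  exists (T, i) => //; split => //; split => //=; rewrite i0 /=.
  by case: (size T) iT.
have fA : finite_set A by apply: sub_finite_set fin_S => s [].
symmetry; apply: set_card_eq; first exact: finite_image.
apply: inj_card_eq => -[T i] [U j] /set_mem[Si Ti _] /set_mem[Sj Uj _] /= TU.
by rewrite -TU in Sj Uj *; rewrite (simple_visit_inj Si Sj Ti Uj).
Qed.

Lemma simple_spatial u :
  spatial D (uniform_mass R (states D)) u =
  (set_card (traces_through D u))%:R / (set_card (states D))%:R.
Proof.
rewrite /spatial esum_uniform_mass //=; last by move=> s [].
have := simple_card_states_at u setT.
rewrite (_ : [set s | [/\ _, _ & _]] =
  [set s | states D s /\ trace_at s.1 s.2 = u]); last first.
  by apply/seteqP; split=> s [] //.
rewrite (_ : [set T | _ /\ setT T] = traces_through D u) => [-> //|].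
by apply/seteqP; split=> T // [].
Qed.

Lemma simple_destination u v : states D !=set0 ->
  destination D (uniform_mass R (states D)) u v =
  (set_card [set T | traces_through D u T /\ trace_end T = v])%:R /
  (set_card (traces_through D u))%:R.
Proof.
move=> S0; rewrite /destination simple_spatial esum_uniform_mass //=.
  rewrite (simple_card_states_at u [set T | trace_end T = v]) /= invfM invrK.
  (* The number of states cancels, being nonzero. If no trace passes through [u], both sides are 0
     because the inverse of 0 is 0. *)
  rewrite mulrC [_^-1 * _]mulrC mulrA divfK // pnatr_eq0 -lt0n.
  exact: set_card_gt0.
by move=> s [].
Qed.

End SimpleModels.

(** * The Manhattan model *)

Section ManhattanPaths.
Context {R : realType}.
Variable eps : R.

Lemma rev_steps i i' : rev (steps i i') = steps i' i.
Proof.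
rewrite /steps; case: (ltngtP i i') => [ii|ii|->]; rewrite ?revK //.
by rewrite subnn.
Qed.

Lemma steps_uniq i i' : uniq (steps i i').
Proof. by rewrite /steps; case: ifP; rewrite ?rev_uniq iota_uniq. Qed.

(** The corner [(i', j)] is listed with the first segment of either path. After reversal it heads
    the horizontal part, and [cat_rcons] moves it to the end of the vertical one. *)
Lemma rev_hv_path i j i' j' :
  rev (hv_path eps i j i' j') = vh_path eps i' j' i j.
Proof.
rewrite /hv_path /vh_path -(rev_steps j j') -(rev_steps i i').
have [s [-> ls _]] := steps_path i i'; have [t [-> _ _]] := steps_path j j'.
rewrite lastI ls rev_cat /= rev_rcons rev_cons !map_rcons rev_rcons /=.
by rewrite cat_rcons !map_rev.
Qed.

Lemma rev_vh_path i j i' j' :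
  rev (vh_path eps i j i' j') = hv_path eps i' j' i j.
Proof. by rewrite -rev_hv_path revK. Qed.

Hypothesis eps_gt0 : 0 < eps.

Lemma grid_point_inj i j i' j' :
  grid_point eps i j = grid_point eps i' j' -> i = i' /\ j = j'.
Proof.
have e0 : eps != 0 by rewrite gt_eqF.
by move=> [/(mulIf e0)/eqP + /(mulIf e0)/eqP]; rewrite !eqr_nat => /eqP + /eqP.
Qed.

Lemma hv_path_uniq i j i' j' : uniq (hv_path eps i j i' j').
Proof.
rewrite /hv_path cat_uniq; apply/and3P; split.
- by rewrite map_inj_uniq ?steps_uniq // => a b /grid_point_inj[].
(* A point common to both segments would have vertical index [j], which heads [steps j j'] and so
   does not recur in its tail. *)
- apply/hasPn => _ /mapP[k kj ->]; apply/negP => /mapP[l _ /grid_point_inj[_]].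
  move=> kj'; have := steps_uniq j j'; move: kj; rewrite kj'.
  by have [t [-> _ _]] := steps_path j j' => /= ->.
rewrite map_inj_uniq => [|a b /grid_point_inj[]//].
by have := steps_uniq j j'; case: (steps j j') => //= a s /andP[].
Qed.

Lemma vh_path_uniq i j i' j' : uniq (vh_path eps i j i' j').
Proof. by rewrite -rev_hv_path rev_uniq hv_path_uniq. Qed.

End ManhattanPaths.

Section TraceEnds.
Context {pt : pointedType}.
Implicit Type T : seq pt.

Lemma trace_start_rev T : trace_start (rev T) = trace_end T.
Proof.
rewrite /trace_start /trace_end /trace_at nth_last nth0.
by case/lastP: T => [//|s x]; rewrite rev_rcons last_rcons.
Qed.

Lemma trace_end_rev T : trace_end (rev T) = trace_start T.
Proof. by rewrite -trace_start_rev revK. Qed.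

Lemma uniq_visits T u : uniq T -> (visits T u <= 1)%N.
Proof.
move=> uT; apply/card_le1_eqP => i j; rewrite !inE.
move=> /andP[_ /eqP <-] /andP[_ /eqP /eqP].
by rewrite nth_uniq // => /eqP ij; apply/val_inj.
Qed.

End TraceEnds.

(** * The Manhattan model meets the hypotheses of the general results *)

Section ManhattanModel.
Context {R : realType}.
Variables (eps : R) (N : nat).
Hypotheses (eps_gt0 : 0 < eps) (N_ge2 : (2 <= N)%N).
Implicit Types (T : seq (R * R)) (p q : R * R).
Let D := manhattan eps N.

Lemma feasible_path_start p q T : feasible_path eps N p q T -> trace_start T = p.
Proof.
move=> [i [j [i' [j' [-> _ [] ->]]]]].
  by have [s [-> _ _]] := hv_path_adjacent i j i' j' eps_gt0.
by have [s [-> _ _]] := vh_path_adjacent i j i' j' eps_gt0.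
Qed.

Lemma feasible_path_rev p q T :
  feasible_path eps N p q T -> feasible_path eps N q p (rev T).
Proof.
move=> [i [j [i' [j' [-> -> ET]]]]]; exists i', j', i, j; split => //.
by case: ET => ->; [right; rewrite rev_hv_path|left; rewrite rev_vh_path].
Qed.

Lemma feasible_path_end p q T : feasible_path eps N p q T -> trace_end T = q.
Proof. by rewrite -trace_start_rev => /feasible_path_rev/feasible_path_start. Qed.

Lemma manhattan_trace_rev T : traces D T -> traces D (rev T).
Proof.
move=> [p [q [gp gq pq fT]]]; exists q, p; split => //; first exact/nesym.
exact: feasible_path_rev.
Qed.

(** Used both to find a trace leaving each grid point and to get strong connectivity in a single
    step. *)
Lemma manhattan_trace_between p q : grid eps N p -> grid eps N q -> p <> q ->
  traces_between D p q !=set0.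
Proof.
move=> gp gq pq; have [[i [j pE]] [i' [j' qE]]] := (gp, gq).
have fT : feasible_path eps N p q (hv_path eps i j i' j').
  by exists i, j, i', j'; split => //; left.
exists (hv_path eps i j i' j').
have DT : traces D (hv_path eps i j i' j') by exists p, q.
by split; split => //; [exact: feasible_path_start fT|exact: feasible_path_end fT].
Qed.

Lemma grid_neighbor p : grid eps N p -> exists2 q, grid eps N q & p <> q.
Proof.
move=> [i [j ->]]; have N0 : (0 < N)%N by exact: ltnW.
(* Columns 0 and 1 both exist since [N] is at least 2; the neighbor is taken in whichever differs
   from column [i]. *)
have [i0|i0] := eqVneq (i : nat) 0%N.
  exists (grid_point eps 1 j); first by exists (Ordinal N_ge2), j.
  by rewrite i0 => /(grid_point_inj eps_gt0)[].
exists (grid_point eps 0 j); first by exists (Ordinal N0), j.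
by move=> /(grid_point_inj eps_gt0)[/eqP]; rewrite (negbTE i0).
Qed.

Lemma manhattan_trace_start T : traces D T -> grid eps N (trace_start T).
Proof. by move=> [p [q [gp _ _ /feasible_path_start ->]]]. Qed.

Lemma manhattan_trace_end T : traces D T -> grid eps N (trace_end T).
Proof. by move=> [p [q [_ gq _ /feasible_path_end ->]]]. Qed.

Lemma manhattan_trace_from p : grid eps N p ->
  exists2 T, traces D T & trace_start T = p.
Proof.
move=> gp; have [q gq pq] := grid_neighbor gp.
by have [T [[DT sT] _]] := manhattan_trace_between gp gq pq; exists T.
Qed.

Lemma manhattan_sources : sources D = grid eps N.
Proof.
apply/seteqP; split => [p [T [DT <-]]|p /manhattan_trace_from[T DT sT]].
  exact: manhattan_trace_start.
by exists T.
Qed.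

Lemma finite_grid : finite_set (grid eps N).
Proof.
apply: (@sub_finite_set _ _
  ((fun k : 'I_N * 'I_N => grid_point eps k.1 k.2) @` setT)).
  by move=> _ [i [j ->]]; exists (i, j).
by apply: finite_image; exact: finite_finset.
Qed.

(** A trace is determined by four grid indices and one of two shapes. *)
Lemma finite_manhattan_traces : finite_set (traces D).
Proof.
pose I := ('I_N * 'I_N * 'I_N * 'I_N)%type.
pose path_of f (k : I) : seq (R * R) := f eps k.1.1.1 k.1.1.2 k.1.2 k.2.
apply: (@sub_finite_set _ _
  (path_of hv_path @` setT `|` path_of vh_path @` setT)).
  move=> T [p [q [_ _ _ [i [j [i' [j' [_ _ []]]]]]]]] ->;
    by [left; exists (i, j, i', j')|right; exists (i, j, i', j')].
by rewrite finite_setU; split; apply: finite_image; exact: finite_finset.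
Qed.

Lemma manhattan_trace_size T : traces D T -> (2 <= size T)%N.
Proof.
move=> [p [q [_ _ pq fT]]]; rewrite leqNgt; apply/negP => sT; apply: pq.
rewrite -(feasible_path_start fT) -(feasible_path_end fT).
(* With fewer than two points the start and the end coincide; on the empty sequence both are the
   default point. *)
by move: sT; rewrite /trace_end /trace_start; case: (T) => [|? []].
Qed.

Lemma manhattan_selective : uniformly_selective D.
Proof.
by move=> u _; split => //; exact: (finite_traces_out finite_manhattan_traces).
Qed.

Lemma manhattan_MTM : is_MTM D.
Proof.
split; first exact: manhattan_trace_size.
- by move=> T /manhattan_trace_end/manhattan_trace_from.
- by rewrite manhattan_sources; exact: finite_grid.
move=> u su; apply: uniform_mass_distribution => //.
exact: (finite_traces_out finite_manhattan_traces).
Qed.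

Lemma manhattan_balanced : balanced D.
Proof.
move=> u _; rewrite (_ : traces_in D u = rev @` traces_out D u).
  by apply: inj_card_eq => T U _ _; exact: (can_inj revK).
apply/seteqP; split => [T [DT eT]|_ [T [DT sT] <-]].
  exists (rev T); last exact: revK.
  by split; [exact: manhattan_trace_rev|rewrite trace_start_rev].
by split; [exact: manhattan_trace_rev|rewrite trace_end_rev].
Qed.

Lemma manhattan_strongly_connected : strongly_connected D.
Proof.
rewrite /strongly_connected manhattan_sources => p q gp gq pq.
exists 1%N, (fun i => if i is 0 then p else q); split => //; first by case.
case=> // _; have [T Tpq] := manhattan_trace_between gp gq pq.
have fin := finite_traces_out finite_manhattan_traces p.
(* One trace from [p] to [q] already contributes positive mass, which bounds the sum from below. *)
apply: (@lt_le_trans _ _ (psi D p T)%:E); last first.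
  apply: esum_ge; exists [set T]; last by rewrite fsbig_set1.
  by split; [exact: finite_set1|move=> _ ->].
have outT : traces_out D p T by case: Tpq.
rewrite lte_fin /= /uniform_mass mem_set // invr_gt0 ltr0n.
by apply: set_card_gt0 => //; exists T.
Qed.

Lemma manhattan_simple : simple_model D.
Proof.
move=> T u [p [q [_ _ _ [i [j [i' [j' [_ _ []]]]]]]]] ->; apply: uniq_visits.
  exact: hv_path_uniq.
exact: vh_path_uniq.
Qed.

Lemma manhattan_traces_nonempty : traces D !=set0.
Proof.
have N0 : (0 < N)%N by exact: ltnW.
have g0 : grid eps N (grid_point eps 0 0) by exists (Ordinal N0), (Ordinal N0).
by have [T DT _] := manhattan_trace_from g0; exists T.
Qed.

End ManhattanModel.

Theorem mainTheorem6 (R : realType) (L eps : R) (N : nat)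
    (L_gt0 : 0 < L) (eps_gt0 : 0 < eps)
    (N_def : N%:Z = Num.ceil (L / eps)) (N_ge2 : (2 <= N)%N) :
  let D := manhattan eps N in
  [/\ is_MTM D, balanced D, uniformly_selective D & strongly_connected D] /\
  simple_model D /\
  exists pi : seq (R * R) * nat -> R,
    [/\ unique (stationary D) pi,
        uniform_on (states D) pi,
        forall u, grid eps N u ->
          spatial D pi u = (set_card (traces_through D u))%:R / (set_card (states D))%:R
      & forall u v, grid eps N u -> grid eps N v ->
          destination D pi u v =
            (set_card [set T | traces_through D u T /\ trace_end T = v])%:R /
            (set_card (traces_through D u))%:R].
Proof.
move=> D.
have mtm : is_MTM D by exact: manhattan_MTM.
have bal : balanced D by exact: manhattan_balanced.
have sel : uniformly_selective D by exact: manhattan_selective.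
have conn : strongly_connected D by exact: manhattan_strongly_connected.
have simp : simple_model D by exact: manhattan_simple.
have fin : finite_set (traces D) by exact: finite_manhattan_traces.
have [T DT] : traces D !=set0 by exact: manhattan_traces_nonempty.
split => //; split => //; exists (uniform_mass R (states D)); split.
- by apply: unique_stationary_uniform => //; exists T.
- by split => //; exact: finite_states.
- by move=> u _; exact: simple_spatial.
move=> u v _ _; apply: simple_destination => //.
by exists (T, 1%N); exact: state_first.
Qed.
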